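(* For every integer $n\geqslant 4$, the monoid $\mathrm{PwEnd}(S_n)$ of all partial weak endomorphisms of the star graph $S_n$ has rank $7$.
   Context: For $n\geqslant1$, the star graph $S_n$ is the simple graph with vertex set $\{0,1,\ldots,n-1\}$ and edge set $E=\{\{0,i\}\mid 1\leqslant i\leqslant n-1\}$ (so $n$ vertices). $\mathcal{PT}(V)$ denotes the monoid of all partial transformations (partial maps $V\to V$, including the empty one) of a finite set $V$ under composition; maps are written on the right and composed left to right. For a graph $G=(V,E)$, a map $\alpha\in\mathcal{PT}(V)$ is a partial weak endomorphism of $G$ if for all $u,v\in\mathrm{Dom}(\alpha)$: $\{u,v\}\in E$ and $u\alpha\neq v\alpha$ imply $\{u\alpha,v\alpha\}\in E$. $\mathrm{PwEnd}(G)$ is the set of all of them; it is a submonoid of $\mathcal{PT}(V)$. The rank of a finite monoid $M$ is the minimum size of a generating set of $M$ (as a monoid). *)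

(* Defs.v *)
From HB Require Import structures.
From mathcomp Require Import all_boot.

Set Implicit Arguments.
Unset Strict Implicit.
Unset Printing Implicit Defensive.

Local Open Scope group_scope.

#[short(type="finMonoidType")]
HB.structure Definition FinMonoid := {M of Monoid M & Finite M}.

Section Rank.
Variable T : finMonoidType.
Implicit Types A M : {set T}.

Definition submonoid M :=
  (1 \in M) && [forall x in M, forall y in M, x * y \in M].

Lemma submonoidP M : reflect (monoid_closed M) (submonoid M).
Proof.
apply: (iffP andP) => [[M1 MM]|[M1 MM]]; split=> //.
  by move=> x y Mx My; have /forall_inP/(_ y My) := forall_inP MM x Mx.
by apply/forall_inP=> x Mx; apply/forall_inP=> y My; apply: MM.
Qed.

Definition monoid_gen A : {set T} :=
  \bigcap_(M : {set T} | (A \subset M) && submonoid M) M.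

Lemma monoid_gen_id M : submonoid M -> monoid_gen M = M.
Proof.
move=> subM; apply/eqP; rewrite eqEsubset bigcap_inf ?subxx //=.
by apply/bigcapsP=> N /andP[].
Qed.

(* Meaningful only when M is a submonoid: then the default value M of the
   minimisation is itself a generating set of M, see monoid_gen_id.  Since M
   contains the unit of T, generating M inside T is the same as generating M as
   a monoid in its own right. *)
Definition mrank M : nat :=
  #|[arg min_(A < M | monoid_gen A == M) #|A|]|.

Lemma mrankP M : submonoid M ->
  (exists2 A, monoid_gen A = M & #|A| = mrank M) /\
  (forall A, monoid_gen A = M -> mrank M <= #|A|)%N.
Proof.
move=> /monoid_gen_id/eqP genM; rewrite /mrank.
case: arg_minnP => // A /eqP genA minA.
by split=> [|B /eqP/minA //]; exists A.
Qed.

End Rank.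

(* None means "outside the domain". *)
Definition ptrans (V : finType) : predArgType := {ffun V -> option V}.

HB.instance Definition _ (V : finType) := Finite.on (ptrans V).

Section PartialTransformations.
Variable V : finType.

(* Maps act on the right: f * g is "f, then g". *)
Definition ptrans_mul (f g : ptrans V) : ptrans V :=
  [ffun x => obind g (f x)].

Definition ptrans_one : ptrans V := [ffun x => Some x].

Lemma ptrans_mulA : associative ptrans_mul.
Proof.
by move=> f g h; apply/ffunP=> x; rewrite !ffunE; case: (f x) => //= y; rewrite ffunE.
Qed.

Lemma ptrans_mul1g : left_id ptrans_one ptrans_mul.
Proof. by move=> f; apply/ffunP=> x; rewrite !ffunE. Qed.

Lemma ptrans_mulg1 : right_id ptrans_one ptrans_mul.
Proof.
by move=> f; apply/ffunP=> x; rewrite !ffunE; case: (f x) => //= y; rewrite ffunE.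
Qed.

HB.instance Definition _ :=
  isMonoid.Build (ptrans V) ptrans_mulA ptrans_mul1g ptrans_mulg1.

End PartialTransformations.

Record sgraph (V : Type) := SGraph {
  adj :> rel V;
  adj_sym : symmetric adj;
  adj_irrefl : irreflexive adj
}.

Section WeakEndomorphisms.
Variables (V : finType) (G : sgraph V).

Definition PwEnd : {set ptrans V} :=
  [set f : ptrans V | [forall u, forall v,
    if (f u, f v) is (Some a, Some b) then G u v && (a != b) ==> G a b
    else true]].

Lemma PwEndP (f : ptrans V) :
  reflect (forall u v a b, f u = Some a -> f v = Some b ->
             G u v -> a != b -> G a b)
          (f \in PwEnd).
Proof.
rewrite inE; apply: (iffP 'forall_forallP) => [wf u v a b fu fv Guv ab | wf u v].
  by have := wf u v; rewrite fu fv Guv ab.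
case fu: (f u) => [a|] //; case fv: (f v) => [b|] //.
by apply/implyP=> /andP[]; apply: wf fu fv.
Qed.

Lemma PwEnd_submonoid : submonoid PwEnd.
Proof.
apply/submonoidP; split.
  by apply/PwEndP=> u v a b; rewrite !ffunE => -[<-] [<-].
move=> f g /PwEndP wf /PwEndP wg; apply/PwEndP=> u v a b; rewrite !ffunE.
case fu: (f u) => [c|] //=; case fv: (f v) => [d|] //= gc gd Guv ab.
have cd : c != d by apply: contraNneq ab => cd; move: gc; rewrite cd gd => -[->].
exact: wg gc gd (wf _ _ _ _ fu fv Guv cd) ab.
Qed.

End WeakEndomorphisms.

Section Star.
Variable n : nat.

Definition star_adj : rel 'I_n :=
  fun i j => ((i == 0 :> nat) && (j != 0 :> nat))
          || ((j == 0 :> nat) && (i != 0 :> nat)).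

Lemma star_adj_sym : symmetric star_adj.
Proof. by move=> i j; rewrite /star_adj orbC. Qed.

Lemma star_adj_irrefl : irreflexive star_adj.
Proof. by move=> i; rewrite /star_adj andbN. Qed.

Definition star := SGraph star_adj_sym star_adj_irrefl.

End Star.

(* Main.v *)
Require Import Defs.
From mathcomp Require Import all_boot all_fingroup.

(** Read a partial map [f] as the self-map [obind f] of [option V] fixing the
    extra point [None].

    Lower bound: if a set [P] of elements avoids the unit and [f * g] in [P]
    forces [f] or [g] into [P], then every generating set meets [P].  For the star
    the following sets are of this kind: the maps whose only collision is a
    single pair of points, of one of the four types {centre, None}, {leaf, None},
    {leaf, centre}, {leaf, leaf} (if [f] itself has no collision it is a
    permutation fixing the centre, which preserves the type); the maps sending
    the centre to a leaf; the units other than 1; and the units not commuting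
    with a given unit [g <> 1].  Their members give 2 + 4 + 1 distinct generators.

    Upper bound: a transposition and a long cycle of the leaves generate the
    units; together with the three maps moving a single leaf to another leaf, to
    the centre or to [None], they generate all maps fixing the centre.  Deleting
    the centre beforehand gives the maps undefined there.  A map sending the
    centre to a leaf [i] takes values in {None, centre, i}, so it factors through
    the map sending the centre to a leaf and all leaves to the centre, followed
    by a transposition. *)

Set Implicit Arguments.
Unset Strict Implicit.
Unset Printing Implicit Defensive.

(** * Generating sets of a submonoid *)

Section MonoidGeneration.
Local Open Scope group_scope.
Variable T : finMonoidType.
Implicit Types A M N : {set T}.

Lemma sub_monoid_gen A : A \subset monoid_gen A.
Proof. by apply/bigcapsP=> M /andP[]. Qed.

Lemma monoid_gen_subset A M : submonoid M -> A \subset M -> monoid_gen A \subset M.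
Proof. by move=> sM AM; apply: bigcap_inf; rewrite AM. Qed.

Lemma submonoid1 M : submonoid M -> 1 \in M.
Proof. by case/submonoidP. Qed.

Lemma submonoidM M f g : submonoid M -> f \in M -> g \in M -> f * g \in M.
Proof. by case/submonoidP=> _; apply. Qed.

Lemma monoid_gen_eq A M : submonoid M -> A \subset M ->
  (forall N, submonoid N -> A \subset N -> M \subset N) -> monoid_gen A = M.
Proof.
move=> sM AM min; apply/eqP; rewrite eqEsubset monoid_gen_subset //=.
by apply/bigcapsP=> N /andP[AN sN]; apply: min.
Qed.

(** If no element of [A] satisfied [P], the elements of [M] outside [P] would form a submonoid
    containing [A], hence all of [M]. *)
Lemma gen_meets_prime A M (P : pred T) :
    submonoid M -> monoid_gen A = M -> ~~ P 1 ->
    {in M &, forall f g, P (f * g) -> P f || P g} ->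
    (exists2 f, f \in M & P f) ->
  exists f, [/\ f \in A, f \in M & P f].
Proof.
move=> sM genA nP1 primeP [f Mf Pf].
have AM : A \subset M by rewrite -genA sub_monoid_gen.
case: (pickP [pred g in A | P g]) => [g /andP[/= Ag Pg]|noA].
  by exists g; split=> //; apply: (subsetP AM).
pose N := [set g in M | ~~ P g].
have sN : submonoid N.
  apply/submonoidP; split=> [|g h]; first by rewrite inE submonoid1.
  rewrite !inE => /andP[Mg Pg] /andP[Mh Ph]; rewrite submonoidM //=.
  by apply: contra (primeP g h Mg Mh) _; rewrite negb_or Pg.
have : f \in N.
  rewrite (subsetP (monoid_gen_subset (A:=A) sN _)) ?genA //.
  apply/subsetP=> g Ag; rewrite inE (subsetP AM) //=.
  by have /= := noA g; rewrite Ag /= => ->.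
by rewrite inE Pf andbF.
Qed.

End MonoidGeneration.

(** * Collisions and elementary maps of partial transformations *)

Section PartialMaps.
Local Open Scope group_scope.
Variable V : finType.
Implicit Types (f g : ptrans V) (x y : option V).

Definition collisions f : {set option V * option V} :=
  [set p | (p.1 != p.2) && (obind f p.1 == obind f p.2)].

Definition elementary (x : V) y : ptrans V :=
  [ffun z => if z == x then y else Some z].

Definition ptrans_perm (s : {perm V}) : ptrans V := [ffun z => Some (s z)].

Lemma obind_mul f g x : obind (f * g) x = obind g (obind f x).
Proof. by case: x => //= z; rewrite ffunE. Qed.

Lemma obind_one x : obind (1 : ptrans V) x = x.
Proof. by case: x => //= z; rewrite ffunE. Qed.

Lemma obind_inj f g : obind f =1 obind g -> f = g.
Proof. by move=> fg; apply/ffunP=> z; apply: (fg (Some z)). Qed.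

(** As [option V] is finite, the injective [obind f] is bijective and can be cancelled. *)
Lemma obind_mul_inj f g : injective (obind (f * g)) ->
  injective (obind f) /\ injective (obind g).
Proof.
move=> fg.
have injf : injective (obind f).
  by move=> x y e; apply: fg; rewrite !obind_mul e.
split=> // x y; have [h fK hK] := injF_bij injf.
by rewrite -(hK x) -(hK y) -!obind_mul => /fg ->.
Qed.

Lemma collisions0 f : (collisions f == set0) = injectiveb (obind f).
Proof.
apply/eqP/injectiveP=> [K0 x y fxy|injf].
  apply/eqP/negPn/negP => xy.
  by have := in_set0 (x, y); rewrite -K0 inE /= xy fxy eqxx.
by apply/setP=> -[x y]; rewrite !inE /= (inj_eq injf) andNb.
Qed.

(* [None] counts as a point: being undefined at [x] is a collision of [Some x]
   with [None]. *)
Definition merges (x y : option V) f :=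
  (x != y) && (collisions f == [set (x, y); (y, x)]).

Lemma merges_inj x y f : merges x y f -> {in predC1 x &, injective (obind f)}.
Proof.
case/andP=> _ /eqP K u v; rewrite !inE => ux vx fuv; apply/eqP/negPn/negP=> uv.
have : (u, v) \in collisions f by rewrite inE /= uv fuv eqxx.
by rewrite K !inE !xpair_eqE (negPf ux) (negPf vx) andbF.
Qed.

Lemma merges_elementary (x : V) y : Some x != y -> merges (Some x) y (elementary x y).
Proof.
move=> xy; rewrite /merges xy /=; apply/eqP/setP=> -[u v]; rewrite !inE !xpair_eqE /=.
have E w : obind (elementary x y) w = if w == Some x then y else w.
  by case: w => [w|] //=; rewrite ffunE.
rewrite !E; case: (eqVneq u (Some x)) => [->|ux]; case: (eqVneq v (Some x)) => [->|vx].
- by rewrite (negPf xy).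
- by rewrite andbF orbF eq_sym.
- by rewrite ux /= andbT.
- by rewrite andbF andNb.
Qed.

(** Collisions of [f] persist in [f * g], so [f] has either the whole single collision or none. In
    the latter case it is a bijection of [option V] carrying the collision over to [g]. *)
Lemma merges_mul x y f g : merges x y (f * g) ->
  merges x y f \/ injective (obind f) /\ merges (obind f x) (obind f y) g.
Proof.
case/andP=> xy /eqP K.
have sK : collisions f \subset collisions (f * g).
  apply/subsetP=> -[u v]; rewrite !inE /= => /andP[-> /eqP e].
  by rewrite !obind_mul e eqxx.
have symK u v : ((u, v) \in collisions f) = ((v, u) \in collisions f).
  by rewrite !inE /= eq_sym [obind f u == _]eq_sym.
have [xyf|xyf] := boolP ((x, y) \in collisions f).
  left; rewrite /merges xy eqEsubset -{1}K sK /=.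
  by apply/subsetP=> p /set2P[] -> //; rewrite symK.
have injf : injective (obind f).
  apply/injectiveP; rewrite -collisions0 -subset0; apply/subsetP=> p pf.
  have := subsetP sK p pf; rewrite K => /set2P[] e; move: pf xyf.
    by rewrite e => ->.
  by rewrite e symK => ->.
right; split=> //; rewrite /merges (inj_eq injf) xy /=; apply/eqP/setP=> -[u v].
have [h fK hK] := injF_bij injf.
rewrite -(hK u) -(hK v); move/setP/(_ (h u, h v)): K.
by rewrite !inE /= !xpair_eqE /= !obind_mul !(inj_eq injf).
Qed.

Lemma merges_unique x y x' y' f : merges x y f -> merges x' y' f ->
  x' = x /\ y' = y \/ x' = y /\ y' = x.
Proof.
case/andP=> _ /eqP K /andP[_ /eqP/setP/(_ (x', y'))].
rewrite K !inE eqxx /= !xpair_eqE.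
by case/orP=> /andP[/eqP-> /eqP->]; [left|right].
Qed.

Lemma ptrans_perm1 : ptrans_perm 1 = 1.
Proof. by apply/ffunP=> z; rewrite !ffunE perm1. Qed.

Lemma ptrans_permM s t : ptrans_perm (s * t) = ptrans_perm s * ptrans_perm t.
Proof. by apply/ffunP=> z; rewrite !ffunE /= ffunE permM. Qed.

Lemma obind_perm_inj s : injective (obind (ptrans_perm s)).
Proof. by case=> [u|] [v|] //=; rewrite !ffunE // => -[/perm_inj->]. Qed.

Lemma elementary_conj (x : V) y (s : {perm V}) :
  ptrans_perm s^-1 * elementary x y * ptrans_perm s =
  elementary (s x) (omap s y).
Proof.
apply: obind_inj; case=> [z|] //; rewrite !obind_mul /= !ffunE /= !ffunE.
rewrite -(inj_eq (@perm_inj _ s)) permKV; case: eqP => _ /=.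
  by case: y => //= y; rewrite ffunE.
by rewrite ffunE permKV.
Qed.

Definition perms_in (N : {set ptrans V}) := [set s | ptrans_perm s \in N].

(** Makes conjugation of permutations available inside [N]; finiteness supplies the inverses. *)
Lemma group_set_perms_in N : submonoid N -> group_set (perms_in N).
Proof.
move=> sN; apply/group_setP; split=> [|s t].
  by rewrite inE ptrans_perm1 submonoid1.
by rewrite !inE ptrans_permM; apply: submonoidM.
Qed.

(* A moved point [x] outside the image is split off by a last factor
   [elementary x (f x)]; if [x = f z], a first factor [tperm x z] makes it a fixed
   point.  Both decrease the number of moved points. *)
Lemma fix_point_ind (z0 : V) (N : {set ptrans V}) : submonoid N ->
    (forall x y : V, x != z0 -> y != z0 -> ptrans_perm (tperm x y) \in N) ->
    (forall (x : V) y, x != z0 -> Some x != y -> elementary x y \in N) ->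
  forall f, f z0 = Some z0 -> f \in N.
Proof.
move=> sN tN eN f; have [m] := ubnP #|[set x | f x != Some x]|.
elim: m f => // m IHm f /ltnSE le_m f0.
case: (pickP [pred x | f x != Some x]) => [x /= fx|fid]; last first.
  suff -> : f = 1 by apply: submonoid1.
  by apply/ffunP=> x; rewrite ffunE; apply/eqP; have /= /negbFE := fid x.
have x0 : x != z0 by apply: contraNneq fx => ->; rewrite f0.
case: (pickP [pred z | f z == Some x]) => [z /= /eqP fz|nfx].
  have zx : z != x by apply: contraNneq fx => {1}<-; rewrite fz.
  have z0' : z != z0.
    by apply: contraNneq x0 => e; move: fz; rewrite e f0 => -[->].
  pose f' := ptrans_perm (tperm x z) * f.
  have f'E u : f' u = f (tperm x z u) by rewrite ffunE /= ffunE.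
  have -> : f = ptrans_perm (tperm x z) * f'.
    by rewrite mulgA -ptrans_permM tperm2 ptrans_perm1 mul1g.
  apply: submonoidM; rewrite ?tN //; apply: IHm; last first.
    by rewrite f'E tpermD // eq_sym.
  apply: leq_trans le_m; apply: proper_card; apply/properP; split.
    apply/subsetP=> u; rewrite !inE f'E.
    case: tpermP => [->|->|//]; first by rewrite fz eqxx.
    by move=> _; rewrite fz; apply: contraNneq zx => -[->].
  by exists x; rewrite !inE ?fx // f'E tpermL fz eqxx.
pose f' : ptrans V := [ffun u => if u == x then Some x else f u].
have -> : f = f' * elementary x (f x).
  apply/ffunP=> u; rewrite !ffunE; case: eqP => [->|_] /=.
    by rewrite ffunE eqxx.
  case fu: (f u) => [v|] //=; rewrite ffunE; case: eqP => // vx.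
  by have /= := nfx u; rewrite fu vx eqxx.
apply: submonoidM; rewrite ?eN // 1?eq_sym //; apply: IHm; last first.
  by rewrite ffunE eq_sym (negPf x0).
apply: leq_trans le_m; apply: proper_card; apply/properP; split.
  by apply/subsetP=> u; rewrite !inE ffunE; case: (eqVneq u x) => [->|]; rewrite ?eqxx.
by exists x; rewrite !inE ?fx // ffunE !eqxx.
Qed.

End PartialMaps.

Lemma cards3_leq (T : finType) (x y z : T) : #|[set x; y; z]| <= 3.
Proof.
apply: leq_trans (leq_card_setU _ _) _.
by rewrite cards1 cards2; case: (_ != _).
Qed.

(** * The star on [k.+4] vertices, with centre [ord0] *)

Section StarMonoid.
Local Open Scope group_scope.
Variable k : nat.
Notation V := 'I_k.+4.
Notation M := (PwEnd (star k.+4)).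
Notation leaf i := (inord i%N : V).
Implicit Types f g : ptrans V.

Lemma eq_leaf i j : i < k.+4 -> j < k.+4 -> (leaf i == leaf j) = (i == j).
Proof. by move=> lti ltj; rewrite -val_eqE /= !inordK. Qed.

Lemma leaf_neq0 i : 0 < i < k.+4 -> leaf i != ord0.
Proof. by case/andP=> i0 lti; rewrite -val_eqE /= inordK -?lt0n. Qed.

Lemma star_adjE (i j : V) : star_adj i j = (i == ord0) (+) (j == ord0).
Proof. by rewrite /star_adj -!val_eqE; case: (_ == _); case: (_ == _). Qed.

(** Every edge contains the centre. If both ends are in the domain, the centre is fixed, and the
    other end, having a different image, lands on a leaf. *)
Lemma PwEnd_center f : f ord0 = None \/ f ord0 = Some ord0 -> f \in M.
Proof.
move=> f0; apply/PwEndP=> u v a b fu fv.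
have center (w c : V) : f w = Some c -> w = ord0 -> c = ord0.
  by move=> + w0; rewrite w0; case: f0 => -> // -[].
rewrite /= !star_adjE.
have [u0|u0] := eqVneq u ord0; have [v0|v0] := eqVneq v ord0 => // _.
  by rewrite (center _ _ fu u0) eqxx eq_sym.
by rewrite (center _ _ fv v0) eqxx addbT.
Qed.

(** Each leaf is adjacent to the centre, so its image, if defined, is [i] or a neighbour of [i]; the
    only neighbour of a leaf is the centre. *)
Lemma PwEnd_image f (i : V) : f \in M -> f ord0 = Some i -> i != ord0 ->
  forall x, obind f x \in [set None; Some ord0; Some i].
Proof.
move=> /PwEndP Mf f0 i0 [u|]; rewrite ?inE //=.
have [->|u0] := eqVneq u ord0; first by rewrite f0 eqxx orbT.
case fu: (f u) => [c|] //=; rewrite !(inj_eq (@Some_inj _)).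
have [//|c0 /=] := eqVneq c ord0; apply/negPn/negP=> ci.
have : star_adj i c by apply: Mf f0 fu _ _; rewrite /= ?star_adjE ?(negPf u0) // eq_sym.
by rewrite star_adjE (negPf i0) (negPf c0).
Qed.

(** If the centre went to a leaf, [obind f] would take at most three values, while at least four
    points of [option V] remain without [x]. *)
Lemma PwEnd_center_of_inj (x : option V) f : f \in M -> {in predC1 x &, injective (obind f)} ->
  f ord0 = None \/ f ord0 = Some ord0.
Proof.
move=> Mf injf; case f0: (f ord0) => [i|]; last by left.
have [->|i0] := eqVneq i ord0; [by right | exfalso].
have sub : obind f @: [set~ x] \subset [set None; Some ord0; Some i].
  by apply/subsetP=> _ /imsetP[y _ ->]; apply: PwEnd_image.
have := subset_leq_card sub; rewrite card_in_imset; last first.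
  by move=> u v; rewrite !inE => ux vx; apply: injf; rewrite !inE.
rewrite cardsC1 card_option card_ord => /leq_trans/(_ (cards3_leq _ _ _)).
by rewrite ltnNge.
Qed.

Lemma PwEnd_inj_center f : f \in M -> injective (obind f) -> f ord0 = Some ord0.
Proof.
move=> Mf injf; case: (PwEnd_center_of_inj (x := None) Mf) => // [x y _ _ /injf //|f0].
by have := injf (Some ord0) None f0.
Qed.

(** The weights 0, 1, 3 give the four types of pairs the distinct sums 1, 3, 4, 6. *)
Definition colour (x : option V) : nat := if x is Some i then (if i == ord0 then 1 else 3)%N else 0.

Lemma colour_inj f x : f \in M -> injective (obind f) -> colour (obind f x) = colour x.
Proof.
move=> Mf injf; have f0 := PwEnd_inj_center Mf injf; case: x => [u|] //=.
have [->|u0] := eqVneq u ord0; first by rewrite f0.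
case fu: (f u) => [v|] /=; last by have := injf (Some u) None fu.
case: eqP => // v0; have := injf (Some u) (Some ord0); rewrite /= fu f0 v0.
by case/(_ erefl)=> e; rewrite e eqxx in u0.
Qed.

(* The sum determines the unordered pair of colours of two distinct points. *)
Definition merges_colour (c : nat) f :=
  [exists x, exists y, (colour x + colour y == c) && merges x y f].

Lemma merges_colourP c f :
  reflect (exists x y, colour x + colour y = c /\ merges x y f) (merges_colour c f).
Proof.
apply: (iffP existsP) => [[x /existsP[y /andP[/eqP]]]|[x [y [e m]]]].
  by exists x, y.
by exists x; apply/existsP; exists y; rewrite e eqxx.
Qed.

Lemma merges_colour_unique c d f : merges_colour c f -> merges_colour d f -> c = d.
Proof.
move=> /merges_colourP[x [y [<- xy]]] /merges_colourP[u [v [<- uv]]].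
by case: (merges_unique xy uv) => -[-> ->]; rewrite // addnC.
Qed.

Lemma merges_colour_center c f : f \in M -> merges_colour c f ->
  f ord0 = None \/ f ord0 = Some ord0.
Proof.
by move=> Mf /merges_colourP[x [y [_ /merges_inj]]]; apply: PwEnd_center_of_inj.
Qed.

Lemma merges_colour_ninj c f : merges_colour c f -> ~ injective (obind f).
Proof.
move=> /merges_colourP[x [y [_ /andP[_ /eqP K]]]] /injectiveP.
by rewrite -collisions0 K => /eqP/setP/(_ (x, y)); rewrite !inE eqxx.
Qed.

Lemma merges_colour_prime c :
  {in M &, forall f g, merges_colour c (f * g) -> merges_colour c f || merges_colour c g}.
Proof.
move=> f g Mf Mg /merges_colourP[x [y [<- /merges_mul[m|[injf m]]]]]; apply/orP.
  by left; apply/merges_colourP; exists x, y.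
by right; apply/merges_colourP; exists (obind f x), (obind f y); rewrite !colour_inj.
Qed.

Lemma merges_colour1 c : ~~ merges_colour c 1.
Proof.
apply/negP=> /merges_colour_ninj; apply=> x y.
by rewrite !obind_one.
Qed.

Lemma ptrans_perm_PwEnd (s : {perm V}) : s ord0 = ord0 -> ptrans_perm s \in M.
Proof. by move=> s0; apply: PwEnd_center; rewrite ffunE s0; right. Qed.

(** If [g] sends a leaf [x] to another leaf [y], take the transposition of [y] with a third leaf
    [c]: the two products send [x] to [c] and to [y]. Four vertices leave room for [c]. *)
Lemma noncommuting_unit g : g \in M -> injective (obind g) -> g != 1 ->
  exists h, [/\ h \in M, injective (obind h) & g * h != h * g].
Proof.
move=> Mg injg g1; have g0 := PwEnd_inj_center Mg injg.
have [x gx] : exists x, g x != Some x.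
  apply/existsP; apply: contraR g1 => /existsPn fx.
  by apply/eqP/ffunP=> x; rewrite ffunE; apply/eqP/negPn.
have x0 : x != ord0 by apply: contraNneq gx => ->; rewrite g0.
case gxE: (g x) gx => [y|]; last by have := injg (Some x) None gxE.
rewrite (inj_eq (@Some_inj _)) => yx.
have y0 : y != ord0.
  apply: contraNneq x0 => e.
  by have := injg (Some x) (Some ord0); rewrite /= gxE g0 e => /(_ erefl)[->].
have [c] : exists c : V, c \notin [set ord0; x; y].
  apply/existsP; rewrite -negb_forall; apply/negP=> /forallP all.
  have : [set: V] \subset [set ord0; x; y] by apply/subsetP=> c _; apply: all.
  move/subset_leq_card; rewrite cardsT card_ord => /leq_trans/(_ (cards3_leq _ _ _)).
  by rewrite ltnNge.
rewrite !inE !negb_or -andbA => /and3P[c0 cx cy].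
exists (ptrans_perm (tperm y c)); split; first by rewrite ptrans_perm_PwEnd // tpermD.
  exact: obind_perm_inj.
apply/eqP=> /ffunP/(_ x); rewrite !ffunE /= gxE /= ffunE tpermL tpermD // gxE.
by case=> e; rewrite e eqxx in cy.
Qed.

Definition moves_center f := if f ord0 is Some i then i != ord0 else false.

(** * Lower bound: seven distinct generators *)

Section LowerBound.
Variable A : {set ptrans V}.
Hypothesis genA : monoid_gen A = M.
Let sM := PwEnd_submonoid (star k.+4).

(** The condition on [u] makes [elementary u y] fix or delete the centre, which puts it in [M]. *)
Lemma gen_meets_merges (u : V) (y : option V) : Some u != y -> (u == ord0 -> y = None) ->
  exists f, [/\ f \in A, f \in M & merges_colour (colour (Some u) + colour y) f].
Proof.
move=> uy u0; apply: (gen_meets_prime sM genA (merges_colour1 _)).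
  exact: merges_colour_prime.
exists (elementary u y).
  apply: PwEnd_center; rewrite ffunE.
  by case: (eqVneq ord0 u) => [e|_]; [left; rewrite u0 // e | right].
by apply/merges_colourP; exists (Some u), y; split=> //; apply: merges_elementary.
Qed.

Lemma gen_meets_moves_center : exists f, [/\ f \in A, f \in M & moves_center f].
Proof.
apply: (gen_meets_prime sM genA); rewrite /moves_center ?ffunE ?eqxx //.
  move=> f g _ _; rewrite ffunE; case: (f ord0) => [i|] //=.
  by have [->|] := eqVneq i ord0; rewrite ?eqxx //=.
(* A constant map is a weak endomorphism, since no two of its values differ. *)
exists [ffun x : V => Some (leaf 1)]; last by rewrite ffunE leaf_neq0.
by apply/PwEndP=> u v a b; rewrite !ffunE => -[<-] [<-]; rewrite eqxx.
Qed.

Lemma gen_card : 7 <= #|A|.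
Proof.
pose inj f := injectiveb (obind f).
have injM f g : inj (f * g) -> inj f /\ inj g.
  by move=> /injectiveP/obind_mul_inj[injf injg]; split; apply/injectiveP.
have [|||g [Ag Mg /andP[/injectiveP injg g1]]] :=
    gen_meets_prime (P := [pred f | inj f && (f != 1)]) sM genA.
- by rewrite /= eqxx andbF.
- move=> f g _ _ /= /andP[/injM[-> ->]] /=; rewrite -negb_and.
  by apply: contra => /andP[/eqP-> /eqP->]; rewrite mul1g.
- exists (ptrans_perm (tperm (leaf 1) (leaf 2))).
    by apply: ptrans_perm_PwEnd; rewrite tpermD // leaf_neq0.
  apply/andP; split; first exact/injectiveP/obind_perm_inj.
  apply/eqP=> /ffunP/(_ (leaf 1)); rewrite !ffunE tpermL => -[] /eqP.
  by rewrite eq_leaf.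
(* The second unit depends on the first: [g] commutes with itself, so [h] differs from [g]. *)
have [|||h [Ah Mh /andP[/injectiveP injh gh]]] :=
    gen_meets_prime (P := [pred f | inj f && (g * f != f * g)]) sM genA.
- by rewrite /= mulg1 mul1g eqxx andbF.
- move=> f f' _ _ /= /andP[/injM[-> ->]] /=; rewrite -negb_and.
  by apply: contra => /andP[/eqP e /eqP e']; rewrite mulgA e -mulgA e' mulgA.
- have [h [Mh injh gh]] := noncommuting_unit Mg injg g1.
  by exists h => //=; rewrite gh andbT; apply/injectiveP.
have [e1 [Ae1 Me1 ce1]] := @gen_meets_merges ord0 None erefl (fun=> erefl).
have l1 : (leaf 1 == ord0) = false by apply: negbTE; rewrite leaf_neq0.
have l2 : (leaf 2 == ord0) = false by apply: negbTE; rewrite leaf_neq0.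
have [|?|e3 [Ae3 Me3 ce3]] := @gen_meets_merges (leaf 1) None; rewrite ?l1 //.
have [||e4 [Ae4 Me4 ce4]] := @gen_meets_merges (leaf 1) (Some ord0).
- by rewrite (inj_eq (@Some_inj _)) l1.
- by rewrite l1.
have [||e6 [Ae6 Me6 ce6]] := @gen_meets_merges (leaf 1) (Some (leaf 2)).
- by rewrite (inj_eq (@Some_inj _)) eq_leaf.
- by rewrite l1.
have [c [Ac Mc cc]] := gen_meets_moves_center.
move: ce1 ce3 ce4 ce6; rewrite /= l1 l2 /= => ce1 ce3 ce4 ce6.
(* Collision types separate the four merging maps from each other; having no collision separates the
   units from them; only [c] sends the centre to a leaf. *)
have merges_neq i j f f' : merges_colour i f -> merges_colour j f' -> i != j -> f != f'.
  by move=> mf mf'; apply: contraNneq => e; rewrite (merges_colour_unique mf (d := j)) ?e.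
have inj_neq i f f' : injective (obind f) -> merges_colour i f' -> f != f'.
  by move=> injf /merges_colour_ninj ninj; apply/eqP=> e; apply: ninj; rewrite -e.
have move_neq i f : f \in M -> merges_colour i f -> c != f.
  move=> Mf mf; apply: contraTneq cc => ->; rewrite /moves_center.
  by case: (merges_colour_center Mf mf) => ->; rewrite ?eqxx.
have inj_move_neq f : f \in M -> injective (obind f) -> f != c.
  move=> Mf /(PwEnd_inj_center Mf) f0; apply: contraTneq cc => <-.
  by rewrite /moves_center f0 eqxx.
have g_h : g != h by apply: contraNneq gh => ->.
have uniq_s : uniq [:: g; h; c; e1; e3; e4; e6].
  rewrite /= !inE !negb_or g_h !inj_move_neq //.
  rewrite !(inj_neq _ _ _ injg ce1, inj_neq _ _ _ injg ce3, inj_neq _ _ _ injg ce4,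
            inj_neq _ _ _ injg ce6, inj_neq _ _ _ injh ce1, inj_neq _ _ _ injh ce3,
            inj_neq _ _ _ injh ce4, inj_neq _ _ _ injh ce6).
  rewrite (move_neq _ _ Me1 ce1) (move_neq _ _ Me3 ce3).
  rewrite (move_neq _ _ Me4 ce4) (move_neq _ _ Me6 ce6).
  by rewrite (merges_neq _ _ _ _ ce1 ce3) // (merges_neq _ _ _ _ ce1 ce4) //
    (merges_neq _ _ _ _ ce1 ce6) // (merges_neq _ _ _ _ ce3 ce4) //
    (merges_neq _ _ _ _ ce3 ce6) // (merges_neq _ _ _ _ ce4 ce6).
have <- : size [:: g; h; c; e1; e3; e4; e6] = 7 by [].
rewrite cardE; apply: uniq_leq_size => // f; rewrite mem_enum !inE.
by do 6!case/predU1P=> [->//|]; move/eqP->.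
Qed.

End LowerBound.

(** * Generating the permutations of the leaves *)

(** The swap cuts 0 out of the rotation of all vertices, leaving the cycle 1, 2, ..., [k.+3] of the
    leaves. *)
Definition leaf_cycle : {perm V} := perm (@ordS_inj k.+4) * tperm ord0 (leaf 1).

Lemma leaf_cycle0 : leaf_cycle ord0 = ord0.
Proof.
have e : ordS (ord0 : V) = leaf 1 by apply: val_inj; rewrite /= inordK.
by rewrite permM (permE (@ordS_inj _)) e tpermR.
Qed.

Lemma leaf_cycleS i : 0 < i -> i.+1 < k.+4 -> leaf_cycle (leaf i) = leaf i.+1.
Proof.
move=> i0 lti; have e : ordS (leaf i) = leaf i.+1.
  by apply: val_inj; rewrite /= !inordK ?modn_small // ltnW.
rewrite permM (permE (@ordS_inj _)) e tpermD // eq_sym ?leaf_neq0 // eq_leaf //.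
by rewrite eqSS -lt0n.
Qed.

(** Conjugation by the cycle gives the transpositions of consecutive leaves; conjugating by these
    gives those involving [leaf 1], and conjugating among the latter gives all. *)
Lemma leaf_tperm_gen (H : {group {perm V}}) :
    tperm (leaf 1) (leaf 2) \in H -> leaf_cycle \in H ->
  forall x y : V, x != ord0 -> y != ord0 -> tperm x y \in H.
Proof.
move=> H12 Hc.
have adjacent i : i.+2 < k.+4 -> tperm (leaf i.+1) (leaf i.+2) \in H.
  elim: i => // i IHi lti.
  by have := groupJ (IHi (ltnW lti)) Hc; rewrite tpermJ !leaf_cycleS // ltnW.
have from1 i : i.+1 < k.+4 -> tperm (leaf 1) (leaf i.+1) \in H.
  elim: i => [|i IHi] lti; first by rewrite tperm1.
  have [->|i0] := posnP i; first exact: H12.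
  rewrite tpermC -(@tpermJ_tperm _ (leaf i.+1)).
  - by rewrite groupJ ?adjacent // tpermC IHi // ltnW.
  - by rewrite eq_leaf ?eqSS -?lt0n // ltnW.
  - by rewrite eq_leaf.
have from1P (x : V) : x != ord0 -> tperm (leaf 1) x \in H.
  rewrite -val_eqE /= -lt0n => x0; rewrite -(inord_val x) -(prednK x0).
  by rewrite from1 // prednK.
move=> x y x0 y0; have [->|xy] := eqVneq x y; first by rewrite tperm1.
have [<-|y1] := eqVneq (leaf 1) y; first by rewrite tpermC from1P.
by rewrite -(tpermJ_tperm y1 xy) groupJ ?from1P.
Qed.

(** * Upper bound: seven generators suffice *)

Definition center_to_leaf : ptrans V :=
  [ffun z => Some (if z == ord0 then leaf 1 else ord0)].

Definition star_gens : seq (ptrans V) :=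
  [:: ptrans_perm (tperm (leaf 1) (leaf 2)); ptrans_perm leaf_cycle;
      elementary (leaf 1) (Some (leaf 2)); elementary (leaf 1) (Some ord0);
      elementary (leaf 1) None; elementary ord0 None; center_to_leaf].

Section UpperBound.
Variable N : {set ptrans V}.
Hypotheses (sN : submonoid N) (gensN : {subset star_gens <= N}).

Lemma tperm_star_gens (x y : V) : x != ord0 -> y != ord0 -> ptrans_perm (tperm x y) \in N.
Proof.
move=> x0 y0; suff : tperm x y \in group (group_set_perms_in sN) by rewrite inE.
by apply: leaf_tperm_gen => //; rewrite inE gensN // !inE eqxx ?orbT.
Qed.

Lemma elementary_tperm (x : V) (y : option V) (u v : V) : u != ord0 -> v != ord0 ->
  elementary x y \in N -> elementary (tperm u v x) (omap (tperm u v) y) \in N.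
Proof.
move=> u0 v0 Nxy; rewrite -elementary_conj tpermV.
by rewrite !submonoidM ?tperm_star_gens.
Qed.

(** Conjugating by the transposition of [leaf 1] and [x] moves the source and keeps the targets
    [None] and centre. A leaf target is first moved away from [leaf 2] by another transposition. *)
Lemma elementary_star_gens (x : V) (y : option V) : x != ord0 -> Some x != y -> elementary x y \in N.
Proof.
move=> x0; have l10 : leaf 1 != ord0 by rewrite leaf_neq0.
have l20 : leaf 2 != ord0 by rewrite leaf_neq0.
have to_x z : elementary (leaf 1) (omap (tperm (leaf 1) x) z) \in N ->
    elementary x z \in N.
  move=> /(elementary_tperm l10 x0); rewrite tpermL.
  by case: z => [z|] //=; rewrite tpermK.
have fixed z : elementary (leaf 1) z \in N -> omap (tperm (leaf 1) x) z = z ->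
    elementary x z \in N.
  by move=> Nz e; have := elementary_tperm l10 x0 Nz; rewrite tpermL e.
case: y => [y|] xy; last by apply: fixed => //; rewrite gensN // !inE eqxx ?orbT.
have [->|y0] := eqVneq y ord0.
  by apply: fixed; rewrite /= ?tpermD // gensN // !inE eqxx ?orbT.
have one_to z : z != ord0 -> z != leaf 1 -> elementary (leaf 1) (Some z) \in N.
  move=> z0 z1; have N12 : elementary (leaf 1) (Some (leaf 2)) \in N.
    by rewrite gensN // !inE eqxx ?orbT.
  have := elementary_tperm l20 z0 N12; rewrite /= tpermL tpermD //.
  by rewrite eq_leaf.
apply/to_x/one_to; first by rewrite -(inj_eq (@perm_inj _ (tperm (leaf 1) x))) tpermK tpermD.
rewrite -(inj_eq (@perm_inj _ (tperm (leaf 1) x))) tpermK tpermL eq_sym.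
by apply: contraNneq xy => ->.
Qed.

Lemma fix_center_gen f : f ord0 = Some ord0 -> f \in N.
Proof. exact: fix_point_ind sN tperm_star_gens elementary_star_gens f. Qed.

Lemma PwEnd_gen f : f \in M -> f \in N.
Proof.
move=> Mf; case f0: (f ord0) => [i|]; last first.
  (* The first factor deletes the centre, so the value of [b] there is free; fixing the centre makes
     [fix_center_gen] apply. *)
  pose b : ptrans V := [ffun z => if z == ord0 then Some ord0 else f z].
  have -> : f = elementary ord0 None * b.
    apply/ffunP=> z; rewrite !ffunE; have [->//|z0] := eqVneq z ord0.
    by rewrite /= ffunE (negPf z0).
  apply: submonoidM => //; last by rewrite fix_center_gen // ffunE eqxx.
  by rewrite gensN // !inE eqxx ?orbT.
have [i0|i0] := eqVneq i ord0; first by rewrite fix_center_gen ?f0 ?i0.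
(* [b] codes the value [i] by the centre and the centre by [leaf 1], so it fixes the centre.
   [center_to_leaf] exchanges the two codes, and the transposition turns [leaf 1] into [i]. *)
pose b : ptrans V := [ffun z =>
  if f z == Some i then Some ord0 else if f z == Some ord0 then Some (leaf 1) else None].
have l10 : leaf 1 != ord0 by rewrite leaf_neq0.
have -> : f = b * center_to_leaf * ptrans_perm (tperm (leaf 1) i).
  apply: obind_inj => -[z|] //; rewrite !obind_mul /= ffunE.
  have := PwEnd_image Mf f0 i0 (Some z); rewrite /= !inE.
  have [-> _|_] := eqVneq (f z) (Some i); first by rewrite /= ffunE /= ffunE tpermL.
  have [-> _|_] := eqVneq (f z) (Some ord0); last by rewrite !orbF => /eqP.
  by rewrite /= ffunE (negPf l10) /= ffunE tpermD.
apply: submonoidM (tperm_star_gens l10 i0) => //; apply: submonoidM => //.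
  by rewrite fix_center_gen // ffunE f0 eqxx.
by rewrite gensN // !inE eqxx ?orbT.
Qed.

End UpperBound.

Lemma star_gens_PwEnd : {subset star_gens <= M}.
Proof.
have l12 : leaf 1 != ord0 /\ leaf 2 != ord0 by split; rewrite leaf_neq0.
case: l12 => l1 l2; have cM : center_to_leaf \in M.
  (* Every edge is mapped onto the edge joining [ord0] and [leaf 1]. *)
  apply/PwEndP=> u v a b; rewrite !ffunE => -[<-] [<-] /=; rewrite !star_adjE.
  by case: (u == ord0); case: (v == ord0); rewrite ?eqxx ?(negPf l1).
apply/allP; rewrite /= cM !PwEnd_center // !ffunE /= ?leaf_cycle0 ?tpermD //; auto.
all: by rewrite eq_sym ?(negPf l1); right.
Qed.

Lemma star_gens_gen : monoid_gen [set f in star_gens] = M.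
Proof.
apply: monoid_gen_eq; first exact: PwEnd_submonoid.
  by apply/subsetP=> f; rewrite inE => /star_gens_PwEnd.
move=> N sN /subsetP gensN; apply/subsetP=> f; apply: PwEnd_gen => // g g_gen.
by apply: gensN; rewrite inE.
Qed.

End StarMonoid.

Theorem theorem3p8 : forall n : nat, 4 <= n -> mrank (PwEnd (star n)) = 7.
Proof.
case=> [|[|[|[|k]]]] // _.
have [[A genA cardA] min_rank] := mrankP (PwEnd_submonoid (star k.+4)).
apply/eqP; rewrite eqn_leq -{2}cardA gen_card // andbT.
(* A list of length seven yields a set of at most seven elements. *)
by apply: leq_trans (min_rank _ (star_gens_gen k)) _; rewrite cardsE card_size.
Qed.
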